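(* For any (finite) tree $T$, $\dim(T) \le Z(T)$.
   Context: $\dim(T)$ is the metric dimension: the minimum cardinality of a set $W\subseteq V(T)$ such that every pair of distinct vertices $u,v$ has some $w\in W$ with $d(u,w)\ne d(v,w)$ ($d$ = shortest-path distance). $Z(T)$ is the zero forcing number: the minimum cardinality of an initial set $S$ of black vertices (others white) such that repeated application of the rule ''if a black vertex has exactly one white neighbor, that neighbor turns black'' eventually turns all vertices black. *)

(* Defs.v *)
From mathcomp Require Import all_boot.

Set Implicit Arguments.
Unset Strict Implicit.
Unset Printing Implicit Defensive.

Section Graph.

Variables (T : finType) (e : rel T).

Definition simple_graph : Prop := symmetric e /\ irreflexive e.

Definition connected_graph : Prop := forall u v : T, connect e u v.

(* In a simple graph the duplicate-free e-cycles of size at most 2 are the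
   degenerate ones: the empty sequence and the two ends of an edge. *)
Definition acyclic_graph : Prop :=
  forall c : seq T, uniq c -> cycle e c -> size c <= 2.

Definition tree : Prop :=
  [/\ simple_graph, 0 < #|T|, connected_graph & acyclic_graph].

Definition has_walk (u v : T) (n : nat) : bool :=
  [exists p : n.-tuple T, path e u p && (last u p == v)].

(* The least length of a walk from u to v. A shortest walk has length less than
   #|T|; the value is #|T| when v is not reachable from u. *)
Definition dist (u v : T) : nat := find (has_walk u v) (iota 0 #|T|).

Definition resolving (W : {set T}) : bool :=
  [forall u, forall v, (u != v) ==> [exists w in W, dist u w != dist v w]].

Definition metric_dim : nat := #|[arg min_(W < [set: T] | resolving W) #|W|]|.

Definition nbhd (u : T) : {set T} := [set v | e u v].

(* One application of the colour-change rule; B and B' are the sets of black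
   vertices before and after. *)
Definition force_step (B B' : {set T}) : bool :=
  [exists u in B, exists v, (nbhd u :\: B == [set v]) && (B' == v |: B)].

Definition zero_forcing (S : {set T}) : bool := connect force_step S [set: T].

Definition zero_forcing_number : nat :=
  #|[arg min_(S < [set: T] | zero_forcing S) #|S|]|.

Lemma dist_eq0 (u v : T) : (dist u v == 0) = (u == v).
Proof.
have T0 : 0 < #|T| by apply/card_gt0P; exists u.
rewrite /dist; case: #|T| T0 => [//|n] _ /=.
have -> : has_walk u v 0 = (u == v).
  apply/existsP/eqP => [[p]|->]; last by exists [tuple]; rewrite /= eqxx.
  by rewrite tuple0 /= => /eqP.
by case: (u == v).
Qed.

Lemma dist_walk (u v : T) : connect e u v -> has_walk u v (dist u v).
Proof.
case/connectP => p0 pth ->.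
case/shortenP: pth => p pth un _.
have sz : size p < #|T| by have := max_card [in u :: p]; rewrite (card_uniqP un).
have hw : has_walk u (last u p) (size p).
  by apply/existsP; exists (in_tuple p); rewrite pth eqxx.
have hs : has (has_walk u (last u p)) (iota 0 #|T|).
  by apply/hasP; exists (size p); rewrite ?mem_iota.
have := nth_find 0 hs; rewrite nth_iota ?add0n //.
by move: hs; rewrite has_find size_iota.
Qed.

Lemma dist_min (u v : T) (p : seq T) :
  path e u p -> last u p = v -> dist u v <= size p.
Proof.
move=> pth lst; have hw : has_walk u v (size p).
  by apply/existsP; exists (in_tuple p); rewrite pth lst eqxx.
rewrite leqNgt; apply/negP => lt.
have szT : size p < #|T|.
  by apply: leq_trans lt _; rewrite -[X in _ <= X](size_iota 0) find_size.
by have := before_find 0 lt; rewrite nth_iota // add0n hw.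
Qed.

Lemma resolvingT : resolving [set: T].
Proof.
apply/forallP => u; apply/forallP => v; apply/implyP => neq_uv.
apply/exists_inP; exists u; rewrite ?inE //.
by have /eqP -> : dist u u == 0; rewrite ?dist_eq0 // eq_sym dist_eq0 eq_sym.
Qed.

Lemma zero_forcingT : zero_forcing [set: T].
Proof. exact: connect0. Qed.

Lemma metric_dimP :
  (exists2 W, resolving W & #|W| = metric_dim) /\
  (forall W, resolving W -> metric_dim <= #|W|).
Proof.
rewrite /metric_dim; case: arg_minnP => [|W rW minW]; first exact: resolvingT.
by split; [exists W | exact: minW].
Qed.

Lemma zero_forcing_numberP :
  (exists2 S, zero_forcing S & #|S| = zero_forcing_number) /\
  (forall S, zero_forcing S -> zero_forcing_number <= #|S|).
Proof.
rewrite /zero_forcing_number; case: arg_minnP => [|S zS minS].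
  exact: zero_forcingT.
by split; [exists S | exact: minS].
Qed.

End Graph.

(* Main.v *)
Require Import Defs.
From mathcomp Require Import all_boot.

Set Implicit Arguments.
Unset Strict Implicit.
Unset Printing Implicit Defensive.

(**
  In a tree every zero forcing set is resolving. If S does not resolve u != v,
  consider the set X of vertices that are not equidistant from u and v: it is
  nonempty and disjoint from S. A vertex x equidistant from u and v that has a
  neighbour in X has at least two: the neighbours of x towards u and towards v
  are distinct and both lie in X. So X is a "fort": the colour-change rule never
  turns a first vertex of X black.
*)

Section TreeDistance.

Context {T : finType} {e : rel T}.

Lemma shortest_walk (u v : T) : connect e u v ->
  exists p, [/\ path e u p, last u p = v & size p = dist e u v].
Proof.
move/dist_walk/existsP => [p /andP[pth /eqP lst]].
by exists p; rewrite size_tuple.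
Qed.

Lemma dist_edge (u x y : T) : connect e u x -> e x y ->
  dist e u y <= (dist e u x).+1.
Proof.
move=> /shortest_walk[p [pth lst <-]] exy.
rewrite -(size_rcons p y).
by apply: dist_min; rewrite ?last_rcons ?rcons_path ?pth ?lst.
Qed.

Lemma dist_pred (u x : T) : connect e u x -> u != x ->
  exists2 z, e z x & dist e u z < dist e u x.
Proof.
move=> /shortest_walk[p]; case/lastP: p => [|p y] [pth lst <-].
  by rewrite -lst eqxx.
move: pth lst; rewrite rcons_path last_rcons size_rcons => /andP[pth ezy] <- _.
by exists (last u p) => //; rewrite ltnS; apply: dist_min.
Qed.

(** This models deleting [x] without changing the vertex type. Excluding [x] at both ends keeps the
    relation symmetric when [e] is. *)
Definition edge_avoiding (x : T) : rel T :=
  [rel a b | [&& e a b, a != x & b != x]].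

Lemma path_avoiding (x a : T) (p : seq T) :
  path e a p -> x \notin a :: p -> path (edge_avoiding x) a p.
Proof.
elim: p a => //= b p IHp a /andP[eab pth]; rewrite inE negb_or => /andP[xa xbp].
rewrite IHp // andbT /edge_avoiding /= eab eq_sym xa /=.
by move: xbp; rewrite inE negb_or eq_sym => /andP[].
Qed.

Lemma path_avoiding_notin (x a : T) (p : seq T) :
  path (edge_avoiding x) a p -> path e a p /\ x \notin p.
Proof.
elim: p a => //= b p IHp a /andP[/and3P[-> _ bx] /IHp[-> xp]].
by rewrite inE negb_or eq_sym bx.
Qed.

(** A shortest walk to [y] through [x] would reach [x] strictly before its end, making [x] closer to
    [u] than [y]. *)
Lemma connect_avoiding (u x y : T) : connect e u y -> y != x ->
  dist e u y <= dist e u x -> connect (edge_avoiding x) u y.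
Proof.
move=> /shortest_walk[p [pth lst szp]] yx le_yx.
apply/connectP; exists p => //; apply: path_avoiding => //; apply/negP => xp.
move: pth lst szp le_yx; case/splitPl: xp => p1 p2 lst1.
rewrite cat_path last_cat lst1 => /andP[pth1 _] lst <-.
case: p2 lst => [/= xy|z p2 _]; first by rewrite xy eqxx in yx.
by rewrite leqNgt size_cat addnS ltnS (leq_trans (dist_min pth1 _)) ?leq_addr.
Qed.

Context (tree_e : tree e).

(* Two such neighbours would be joined by a path avoiding x, hence would close
   up a cycle through x. *)
Lemma tree_neighbour_towards (u x y z : T) : e x y -> e x z ->
  dist e u y <= dist e u x -> dist e u z <= dist e u x -> y = z.
Proof.
case: tree_e => -[sym_e irr_e] _ conn_e acyc_e exy exz le_y le_z.
have neq_x a : e x a -> a != x by apply: contraTneq => ->; rewrite irr_e.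
have sym_x : connect_sym (edge_avoiding x).
  apply: sym_connect_sym => a b.
  by rewrite /edge_avoiding /= sym_e [_ && (b != x)]andbC.
have: connect (edge_avoiding x) y z.
  apply: (@connect_trans _ _ u); last first.
    exact: connect_avoiding (neq_x _ exz) le_z.
  by rewrite sym_x; apply: connect_avoiding (neq_x _ exy) le_y.
case/connectP => p0 pth0 lst0.
move: pth0 lst0 => /shortenP[p pth uniq_p _] lst.
have [pth_e xp] := path_avoiding_notin pth.
have uniq_c : uniq [:: x, y & p].
  by rewrite cons_uniq uniq_p andbT inE negb_or xp eq_sym neq_x.
have cyc : cycle e [:: x, y & p].
  by rewrite /= exy rcons_path pth_e -lst sym_e exz.
(* An empty [p] means [y = z]; otherwise the cycle has at least three vertices. *)
by have := acyc_e _ uniq_c cyc; case: p lst {pth uniq_p pth_e xp uniq_c cyc}.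
Qed.

Lemma equidistant_fort (u v x y : T) : u != v ->
  dist e u x = dist e v x -> e x y -> dist e u y != dist e v y ->
  exists z, [/\ e x z, dist e u z != dist e v z & z != y].
Proof.
(* By symmetry in [u] and [v], let [y] be closer to [u]; it is then the neighbour of [x] towards
   [u], and the one towards [v] will be the witness. *)
move=> + + exy; wlog lt_y : u v / dist e u y < dist e v y => [IH uv eq_x|].
  rewrite neq_ltn => /orP[] lt_y.
    by apply: (IH u v) => //; rewrite ltn_eqF.
  have [||z [exz neq_z zy]] := IH v u lt_y _ (esym eq_x).
  - by rewrite eq_sym.
  - by rewrite ltn_eqF.
  by exists z; rewrite eq_sym.
case: tree_e => -[sym_e irr_e] _ conn_e _ uv eq_x _.
have ux : u != x.
  apply: contraNneq uv => ux; rewrite eq_sym -(dist_eq0 e).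
  by rewrite ux -eq_x ux dist_eq0.
have vx : v != x.
  by rewrite -(dist_eq0 e) -eq_x dist_eq0.
have [a eax lt_a] := dist_pred (conn_e _ _) ux.
have [b ebx lt_b] := dist_pred (conn_e _ _) vx.
have step w c : e c x -> dist e w x <= (dist e w c).+1.
  exact: dist_edge (conn_e _ _).
have le_y : dist e u y <= dist e u x.
  by rewrite eq_x -ltnS (leq_trans lt_y) // dist_edge.
have ya : y = a.
  by apply: tree_neighbour_towards exy _ le_y (ltnW lt_a); rewrite sym_e.
(* If [a = b], then [y] is closer than [x] to [v], so [dist e v y < dist e v x = dist e u x <= (dist
   e u y).+1], against [lt_y]. *)
have ab : a != b.
  apply: contraTneq lt_y => ab; rewrite ya {2}ab -leqNgt -ltnS.
  by rewrite (leq_trans lt_b) // -eq_x step.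
exists b; rewrite sym_e ebx ya [b == a]eq_sym ab; split=> //.
(* Were [b] equidistant, it would also be closer than [x] to [u], and such a neighbour is unique. *)
apply: contraNneq ab => eq_b; apply/eqP.
apply: (tree_neighbour_towards (u := u) (x := x) _ _ (ltnW lt_a));
  by rewrite 1?sym_e // eq_b eq_x ltnW.
Qed.

End TreeDistance.

(** Disjointness from [X] survives each colour change: the forcing vertex is black, hence outside
    [X], and if its only white neighbour were in [X], then [z] would be a second one. But the final
    set, all of [T], meets [X]. *)
Lemma zero_forcing_meets_fort {T : finType} {e : rel T} (X S : {set T}) :
  (forall x y, x \notin X -> e x y -> y \in X ->
     exists z, [/\ e x z, z \in X & z != y]) ->
  X != set0 -> zero_forcing e S -> ~~ [disjoint X & S].
Proof.
move=> fortX X_n0 /connectP[s]; elim: s S => [|B s IHs] S /=.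
  by move=> _ <-; apply: contraNN X_n0; rewrite -setI_eq0 setIT.
case/andP=> /exists_inP[x xS /existsP[y /andP[/eqP whites /eqP defB]]] pth lst.
apply: contraNN (IHs B pth lst) => dXS.
have xX : x \notin X by rewrite (disjointFl dXS).
have: y \in nbhd e x :\: S by rewrite whites set11.
rewrite !inE => /andP[_ exy].
rewrite defB -setI_eq0 setIUr setU_eq0 setI_eq0 [X :&: S == _]setI_eq0 dXS andbT.
rewrite disjoint_sym disjoints1.
apply/negP => yX; have [z [exz zX zy]] := fortX x y xX exy yX.
have: z \in nbhd e x :\: S by rewrite !inE exz (disjointFr dXS).
by rewrite whites inE (negPf zy).
Qed.

Lemma tree_zero_forcing_resolving {T : finType} {e : rel T} (S : {set T}) :
  tree e -> zero_forcing e S -> resolving e S.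
Proof.
move=> tree_e zfS; apply/'forall_forallP => u v; apply/implyP => uv.
pose X := [set w | dist e u w != dist e v w].
have fortX x y : x \notin X -> e x y -> y \in X ->
    exists z, [/\ e x z, z \in X & z != y].
  rewrite !inE negbK => /eqP eq_x exy neq_y.
  have [z [exz neq_z zy]] := equidistant_fort tree_e uv eq_x exy neq_y.
  by exists z; rewrite inE.
have X_n0 : X != set0.
  (* [u] is at distance 0 from itself but not from [v]. *)
  apply/set0Pn; exists u; rewrite inE.
  have /eqP -> : dist e u u == 0 by rewrite dist_eq0.
  by rewrite eq_sym dist_eq0 eq_sym.
have := zero_forcing_meets_fort fortX X_n0 zfS.
rewrite -setI_eq0 => /set0Pn[w]; rewrite !inE => /andP[neq_w wS].
by apply/exists_inP; exists w.
Qed.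

Theorem theorem2p8 (T : finType) (e : rel T) (hT : tree e) :
  metric_dim e <= zero_forcing_number e.
Proof.
have [[S zfS <-] _] := zero_forcing_numberP e.
have [_ min_dim] := metric_dimP e.
exact/min_dim/tree_zero_forcing_resolving.
Qed.
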